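(* For every $X\in\operatorname{skew}(p)\times\mathbb{R}^{(n-p)\times p}$, the absolute condition of $\varphi_E^{\mathsf{Cay}}$ at $X$ is bounded by $$\|d(\varphi_E^{\mathsf{Cay}})_X\|_F\le 3.$$
   Context: Let $p\le n$ be positive integers; $\operatorname{skew}(p)$ is the space of real skew-symmetric $p\times p$ matrices, and elements of $\operatorname{skew}(p)\times\mathbb{R}^{(n-p)\times p}$ are written as stacked $n\times p$ matrices $\begin{bmatrix} A \\ B \end{bmatrix}$. With $\operatorname{Cay}(A)=(I-A)^{-1}(I+A)$, $$\varphi^{\mathsf{Cay}}_E\left(\begin{bmatrix} A \\ B \end{bmatrix}\right)=\begin{bmatrix} \operatorname{Cay}(\tfrac12A) \\ B \end{bmatrix}(I_p+B^TB)^{-1/2}\in\mathbb{R}^{n\times p}.$$ The absolute condition of a differentiable map $F$ at $X$ is the operator norm of its differential $dF_X$. For a linear map $L$ between matrix vector spaces, $\|L\|_F=\sup_{M\ne0}\|LM\|_F/\|M\|_F$ is the operator norm induced by the Frobenius norm. *)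

(* Defs.v *)
From HB Require Import structures.
From mathcomp Require Import all_boot all_order all_algebra.
From mathcomp Require Import all_classical all_reals all_analysis.
Set Implicit Arguments.
Unset Strict Implicit.
Unset Printing Implicit Defensive.
Import Order.TTheory GRing.Theory Num.Theory.
Import numFieldNormedType.Exports.
Local Open Scope classical_set_scope.
Local Open Scope ring_scope.

Definition skew_pred (R : realType) (p : nat) : {pred 'M[R]_p} :=
  fun A => A^T == - A.

Lemma skew_pred_submod_closed (R : realType) (p : nat) :
  submod_closed (@skew_pred R p).
Proof.
split=> [|a A B]; rewrite !unfold_in /=.
  by rewrite trmx0 oppr0.
by move=> /eqP hA /eqP hB; rewrite linearP /= hA hB opprD scalerN.
Qed.

HB.instance Definition _ (R : realType) (p : nat) :=
  GRing.isSubmodClosed.Build R 'M[R]_p (@skew_pred R p)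
    (@skew_pred_submod_closed R p).

Record skew_space (R : realType) (p : nat) :=
  Skew { skew_val :> 'M[R]_p ; _ : skew_val \in @skew_pred R p }.

HB.instance Definition _ (R : realType) (p : nat) :=
  [isSub for @skew_val R p].
HB.instance Definition _ (R : realType) (p : nat) :=
  [Choice of skew_space R p by <:].
HB.instance Definition _ (R : realType) (p : nat) :=
  [SubChoice_isSubLmodule of skew_space R p by <:].

(* skew(p) carries the norm inherited from the matrix space 'M[R]_p.  It only
   provides the topology used by 'd; the operator norm below is taken with
   respect to the Frobenius norm. *)
Section SkewNorm.
Variables (R : realType) (p : nat).

Let nrm (A : skew_space R p) : R := `|skew_val A|.

Let nrm_ler_normD (A B : skew_space R p) : nrm (A + B) <= nrm A + nrm B.
Proof. by rewrite /nrm [skew_val (A + B)](raddfD val); exact: ler_normD. Qed.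

Let nrm_normrZ (l : R) (A : skew_space R p) : nrm (l *: A) = `|l| * nrm A.
Proof. by rewrite /nrm -normrZ; congr `|_|; exact: (linearZ_LR val). Qed.

Let nrm_normr0_eq0 (A : skew_space R p) : nrm A = 0 -> A = 0.
Proof. by move=> /normr0_eq0 A0; apply: val_inj; rewrite raddf0. Qed.

HB.instance Definition _ :=
  Lmodule_isNormed.Build R (skew_space R p)
    nrm_ler_normD nrm_normrZ nrm_normr0_eq0.
End SkewNorm.

Definition frobenius (R : realType) (m n : nat) (A : 'M[R]_(m, n)) : R :=
  Num.sqrt (\sum_(i < m) \sum_(j < n) A i j ^+ 2).

Definition sym_posdef (R : realType) (p : nat) (S : 'M[R]_p) : Prop :=
  S^T = S /\ forall x : 'cV[R]_p, x != 0 -> 0 < (x^T *m S *m x) 0 0.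

(* The principal square root: the symmetric positive definite S with S^2 = M,
   which is unique and exists as soon as M is symmetric positive definite
   (junk value 0 when there is none). *)
Definition sqrtmx (R : realType) (p : nat) (M : 'M[R]_p) : 'M[R]_p :=
  xget 0 [set S : 'M[R]_p | sym_posdef S /\ S *m S = M].

Definition Cay (R : realType) (p : nat) (A : 'M[R]_p) : 'M[R]_p :=
  invmx (1%:M - A) *m (1%:M + A).

(* An element of skew(p) x R^(k x p) is a pair (A, B); [stack] is the matrix
   it is written as, with n = p + k rows. *)
Definition stack (R : realType) (n p k : nat) (e : (p + k)%N = n)
    (X : (skew_space R p * 'M[R]_(k, p))%type) : 'M[R]_(n, p) :=
  castmx (e, erefl p) (col_mx (skew_val X.1) X.2).

Definition phiCay (R : realType) (n p k : nat) (e : (p + k)%N = n)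
    (X : (skew_space R p * 'M[R]_(k, p))%type) : 'M[R]_(n, p) :=
  castmx (e, erefl p) (col_mx (Cay (2^-1 *: skew_val X.1)) X.2)
    *m invmx (sqrtmx (1%:M + X.2^T *m X.2)).

(* Operator norm of L with respect to norms nV and nW, valued in \bar R so
   that an unbounded L has norm +oo.  Adjoining 0 only matters for V = {0}
   (e.g. skew(1) with n = p), where the supremum is over the empty set. *)
Definition opnorm (R : realType) (V W : lmodType R) (nV : V -> R) (nW : W -> R)
    (L : V -> W) : \bar R :=
  ereal_sup (0%E |` [set (nW (L M) / nV M)%:E | M in [set M : V | M != 0]]).

(* ||d(phiCay)_X||_F *)
Definition abs_cond_phiCay (R : realType) (n p k : nat) (e : (p + k)%N = n)
    (X : (skew_space R p * 'M[R]_(k, p))%type) : \bar R :=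
  opnorm (fun M => frobenius (stack e M)) (@frobenius R n p)
    ('d (phiCay e) X).

(* Main.v *)
From HB Require Import structures.
Require Import Defs.
From mathcomp Require Import all_boot all_order all_algebra.
From mathcomp Require Import spectral sesquilinear complex ring lra.
From mathcomp Require Import all_classical all_reals all_analysis.
Import Order.TTheory GRing.Theory Num.Theory.
Import numFieldNormedType.Exports.
Local Open Scope ring_scope.

(** Write C = Cay(A/2), S = (I + B^T B)^(1/2) and T = S^-1, so that
    phi = [C; B] T. In a direction (M, N),
      dphi = [U M U; N] T - [C; B] T (W T),
    where U = (I - A/2)^-1 and W = dS solves the Sylvester equation
    S W + W S = N^T B + B^T N. Since U and T are contractions, the first term
    has norm at most ||(M, N)||. Since [C; B] T has orthonormal columns, the
    second one has norm ||W T||. Conjugating the Sylvester equation by T gives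
    W T + T W = T (N^T B + B^T N) T, whose right-hand side has norm at most
    2 ||N|| because B T is a contraction, while ||W T|| <= ||W T + T W||
    because <W T, T W> >= 0. The same positivity argument bounds the inverse of
    the Sylvester operator, which gives the differentiability of S. *)

Set Implicit Arguments.
Unset Strict Implicit.
Unset Printing Implicit Defensive.

(** * The Frobenius norm: trace form, Cauchy-Schwarz, submultiplicativity, comparison with the sup
    norm *)

Section FrobeniusNorm.
Variable R : realType.
Implicit Types m n k : nat.

Lemma mxtrace_trmul m n (A B : 'M[R]_(m, n)) :
  \tr (A^T *m B) = \sum_i \sum_j A i j * B i j.
Proof.
rewrite exchange_big; apply: eq_bigr => j _ /=; rewrite mxE.
by apply: eq_bigr => i _; rewrite mxE.
Qed.

Lemma mxtrace_trmul_ge0 m n (A : 'M[R]_(m, n)) : 0 <= \tr (A^T *m A).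
Proof.
rewrite mxtrace_trmul; do 2! apply: sumr_ge0 => ? _.
by rewrite -expr2 sqr_ge0.
Qed.

Lemma mxtrace_trmulC m n (A B : 'M[R]_(m, n)) : \tr (A^T *m B) = \tr (B^T *m A).
Proof. by rewrite -mxtrace_tr trmx_mul trmxK. Qed.

Lemma frobenius_ge0 m n (A : 'M[R]_(m, n)) : 0 <= frobenius A.
Proof. exact: sqrtr_ge0. Qed.

Lemma frobenius_sqr m n (A : 'M[R]_(m, n)) : frobenius A ^+ 2 = \tr (A^T *m A).
Proof.
rewrite sqr_sqrtr ?mxtrace_trmul //.
by do 2! apply: sumr_ge0 => ? _; exact: sqr_ge0.
Qed.

Lemma frobenius_le m n m' n' (A : 'M[R]_(m, n)) (B : 'M[R]_(m', n')) :
  frobenius A ^+ 2 <= frobenius B ^+ 2 -> frobenius A <= frobenius B.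
Proof. by rewrite ler_sqr ?nnegrE ?frobenius_ge0. Qed.

Lemma frobenius_eq m n m' n' (A : 'M[R]_(m, n)) (B : 'M[R]_(m', n')) :
  frobenius A ^+ 2 = frobenius B ^+ 2 -> frobenius A = frobenius B.
Proof. by move=> e; apply/le_anti; rewrite !frobenius_le ?e. Qed.

Lemma frobenius_tr m n (A : 'M[R]_(m, n)) : frobenius A^T = frobenius A.
Proof. by apply: frobenius_eq; rewrite !frobenius_sqr trmxK mxtrace_mulC. Qed.

Lemma frobeniusN m n (A : 'M[R]_(m, n)) : frobenius (- A) = frobenius A.
Proof.
apply: frobenius_eq.
by rewrite !frobenius_sqr [(- A)^T]raddfN /= mulNmx mulmxN opprK.
Qed.

Lemma frobeniusZ m n a (A : 'M[R]_(m, n)) : frobenius (a *: A) = `|a| * frobenius A.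
Proof.
apply/eqP; rewrite -(eqrXn2 (ltn0Sn 1)) ?mulr_ge0 ?frobenius_ge0 //.
rewrite exprMn (real_normK (num_real _)) !frobenius_sqr.
rewrite [(a *: A)^T]linearZ /= -scalemxAl -scalemxAr.
by rewrite !mxtraceZ mulrA -expr2.
Qed.

Lemma frobenius_coord m n (A : 'M[R]_(m, n)) i j : `|A i j| <= frobenius A.
Proof.
rewrite -ler_sqr ?nnegrE ?frobenius_ge0 // (real_normK (num_real _)) frobenius_sqr.
rewrite mxtrace_trmul (bigD1 i) //= (bigD1 j) //= -expr2 -addrA lerDl addr_ge0 //.
  by apply: sumr_ge0 => ? _; rewrite -expr2 sqr_ge0.
by do 2! apply: sumr_ge0 => ? _; rewrite -expr2 sqr_ge0.
Qed.

Lemma frobenius0_eq0 m n (A : 'M[R]_(m, n)) : frobenius A <= 0 -> A = 0.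
Proof.
move=> A0; apply/matrixP => i j; rewrite mxE; apply/normr0_eq0/le_anti.
by rewrite normr_ge0 (le_trans (frobenius_coord A i j)).
Qed.

Lemma frobenius0 m n : frobenius (0 : 'M[R]_(m, n)) = 0.
Proof. by apply/eqP; rewrite -sqrf_eq0 frobenius_sqr mulmx0 mxtrace0. Qed.

Lemma frobenius_sqrD m n (A B : 'M[R]_(m, n)) :
  frobenius (A + B) ^+ 2 =
  frobenius A ^+ 2 + \tr (A^T *m B) *+ 2 + frobenius B ^+ 2.
Proof.
rewrite !frobenius_sqr [(A + B)^T]linearD /= mulmxDl !mulmxDr !mxtraceD mulr2n.
by rewrite (mxtrace_trmulC B A) !addrA.
Qed.

(** With [a], [b] the norms of [A], [B] and [t] the trace, expanding the squared norm of
    [b *: A - a *: B] gives [a b (a b - t) >= 0]. The cases [a = 0] and [b = 0] are split off so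
    that [a b] can be cancelled. *)
Lemma cauchy_schwarz_mx m n (A B : 'M[R]_(m, n)) :
  \tr (A^T *m B) <= frobenius A * frobenius B.
Proof.
set a := frobenius A; set b := frobenius B.
have [b0|b0] := eqVneq b 0.
  have -> : B = 0 by apply: frobenius0_eq0; rewrite -/b b0.
  by rewrite mulmx0 mxtrace0 mulr_ge0 ?frobenius_ge0.
have [a0|a0] := eqVneq a 0.
  have -> : A = 0 by apply: frobenius0_eq0; rewrite -/a a0.
  by rewrite trmx0 mul0mx mxtrace0 mulr_ge0 ?frobenius_ge0.
have ap : 0 < a by rewrite lt0r a0 frobenius_ge0.
have bp : 0 < b by rewrite lt0r b0 frobenius_ge0.
have := mxtrace_trmul_ge0 (b *: A - a *: B).
rewrite -frobenius_sqr frobenius_sqrD frobeniusN !frobeniusZ.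
rewrite [(_ *: A)^T]linearZ /= -scalemxAl mulmxN -scalemxAr !(mxtraceZ, raddfN) /=.
rewrite !mxtraceZ !ger0_norm ?frobenius_ge0 // -/a -/b.
set t := \tr _ => h.
have {}h : 0 <= (a * b) * (a * b - t) *+ 2.
  by apply: le_trans h _; rewrite le_eqVlt; apply/orP; left; apply/eqP; ring.
by move: h; rewrite pmulrn_lge0 // pmulr_rge0 ?mulr_gt0 // subr_ge0.
Qed.

Lemma cauchy_schwarz_mx_sqr m n (A B : 'M[R]_(m, n)) :
  \tr (A^T *m B) ^+ 2 <= frobenius A ^+ 2 * frobenius B ^+ 2.
Proof.
rewrite -exprMn -(real_normK (num_real (\tr _))) ler_sqr ?nnegrE //; last first.
  by rewrite mulr_ge0 ?frobenius_ge0.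
rewrite ler_norml cauchy_schwarz_mx andbT lerNl.
by rewrite -(frobeniusN B) -raddfN /= -mulmxN cauchy_schwarz_mx.
Qed.

Lemma ler_frobeniusD m n (A B : 'M[R]_(m, n)) :
  frobenius (A + B) <= frobenius A + frobenius B.
Proof.
rewrite -ler_sqr ?nnegrE ?addr_ge0 ?frobenius_ge0 // frobenius_sqrD sqrrD.
by rewrite lerD2r lerD2l lerMn2r cauchy_schwarz_mx.
Qed.

Lemma ler_frobeniusB m n (A B : 'M[R]_(m, n)) :
  frobenius (A - B) <= frobenius A + frobenius B.
Proof. by rewrite -(frobeniusN B) ler_frobeniusD. Qed.

Lemma frobenius_sqr_sum m n (A : 'M[R]_(m, n)) :
  frobenius A ^+ 2 = \sum_i \sum_j A i j ^+ 2.
Proof. by rewrite frobenius_sqr mxtrace_trmul. Qed.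

Lemma ler_frobeniusM m n k (A : 'M[R]_(m, n)) (B : 'M[R]_(n, k)) :
  frobenius (A *m B) <= frobenius A * frobenius B.
Proof.
rewrite -ler_sqr ?nnegrE ?mulr_ge0 ?frobenius_ge0 // exprMn.
(* Each entry of the product pairs a row of [A] with a column of [B]; the sum of the bounds over [i]
   and [j] then factors. *)
have entry i j : (A *m B) i j ^+ 2 <=
    frobenius (row i A) ^+ 2 * frobenius (col j B) ^+ 2.
  have := cauchy_schwarz_mx_sqr (row i A)^T (col j B).
  rewrite trmxK frobenius_tr; apply: le_trans; rewrite le_eqVlt; apply/orP; left.
  rewrite /mxtrace big_ord1 !mxE; apply/eqP; congr (_ ^+ 2).
  by apply: eq_bigr => l _; rewrite !mxE.
have rowsE : frobenius A ^+ 2 = \sum_i frobenius (row i A) ^+ 2.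
  rewrite frobenius_sqr_sum; apply: eq_bigr => i _.
  rewrite frobenius_sqr_sum big_ord1.
  by apply: eq_bigr => j _; rewrite mxE.
have colsE : frobenius B ^+ 2 = \sum_j frobenius (col j B) ^+ 2.
  rewrite frobenius_sqr_sum exchange_big; apply: eq_bigr => j _ /=.
  rewrite frobenius_sqr_sum.
  by apply: eq_bigr => i _; rewrite big_ord1 mxE.
rewrite rowsE colsE big_distrlr /= frobenius_sqr_sum.
by do 2! apply: ler_sum => ? _.
Qed.

Lemma frobenius_col_mx m1 m2 n (A : 'M[R]_(m1, n)) (B : 'M[R]_(m2, n)) :
  frobenius (col_mx A B) ^+ 2 = frobenius A ^+ 2 + frobenius B ^+ 2.
Proof. by rewrite !frobenius_sqr tr_col_mx mul_row_col mxtraceD. Qed.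

Lemma mx_norm_le_frobenius m n (A : 'M[R]_(m, n)) : `|A| <= frobenius A.
Proof.
rewrite [leLHS]/Num.norm /= mx_normrE; apply/bigmax_leP; split=> [|i _].
  exact: frobenius_ge0.
exact: frobenius_coord.
Qed.

(** A crude constant suffices: the bound serves only to show that linear maps are bounded for the
    norm that defines the topology. *)
Lemma frobenius_le_mx_norm m n (A : 'M[R]_(m, n)) :
  frobenius A <= (m * n)%:R * `|A|.
Proof.
rewrite -ler_sqr ?nnegrE ?mulr_ge0 ?frobenius_ge0 // frobenius_sqr_sum.
apply: (@le_trans _ _ (\sum_(i < m) \sum_(j < n) `|A| ^+ 2)).
  apply: ler_sum => i _; apply: ler_sum => j _.
  rewrite -(real_normK (num_real (A _ _))) ler_sqr ?nnegrE //.
  rewrite [leRHS]/Num.norm /= mx_normrE.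
  by apply/bigmax_geP; right => /=; exists (i, j).
rewrite !sumr_const !card_ord -mulrnA mulnC -[leLHS]mulr_natl exprMn.
rewrite ler_wpM2r ?sqr_ge0 // -natrX ler_nat.
by case: (m * n)%N => // k; rewrite leq_pmulr.
Qed.

End FrobeniusNorm.

(** * Matrices with Gram matrix [1 + B^T B] *)

Section Expansive.
Variables (R : realType) (p k : nat) (S : 'M[R]_p) (B : 'M[R]_(k, p)).
Hypothesis gramS : S^T *m S = 1%:M + B^T *m B.

(** Applied later to [1 - A] with [A] skew (taking [B = A]) and to the square root of
    [1 + B^T B]. *)
Lemma frobenius_sqr_gram n (Z : 'M[R]_(p, n)) :
  frobenius (S *m Z) ^+ 2 = frobenius Z ^+ 2 + frobenius (B *m Z) ^+ 2.
Proof.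
rewrite !frobenius_sqr !trmx_mul !mulmxA -(mulmxA _ _ S) gramS.
by rewrite mulmxDr mulmx1 mulmxDl mxtraceD !mulmxA.
Qed.

Lemma frobenius_gram_ge n (Z : 'M[R]_(p, n)) : frobenius Z <= frobenius (S *m Z).
Proof. by rewrite frobenius_le // frobenius_sqr_gram lerDl sqr_ge0. Qed.

Lemma gram_unit : S \in unitmx.
Proof.
(* [S] kills its cokernel matrix and does not decrease norms, so that matrix is zero. *)
rewrite -row_full_unit -cokermx_eq0; apply/eqP/frobenius0_eq0.
by rewrite (le_trans (frobenius_gram_ge _)) // mulmx_coker frobenius0.
Qed.

Lemma frobenius_invmx_gram n (Z : 'M[R]_(p, n)) :
  frobenius (invmx S *m Z) <= frobenius Z.
Proof. by rewrite (le_trans (frobenius_gram_ge _)) // mulKVmx ?gram_unit. Qed.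

Lemma frobenius_mul_invmx_gram n (Z : 'M[R]_(p, n)) :
  frobenius (B *m invmx S *m Z) <= frobenius Z.
Proof.
rewrite frobenius_le // -[in leRHS](mulKVmx gram_unit Z) frobenius_sqr_gram.
by rewrite mulmxA lerDr sqr_ge0.
Qed.

End Expansive.

(** * Positive definite matrices *)

Section PosDef.
Variables (R : realType) (p : nat).
Implicit Types S E : 'M[R]_p.

Lemma posdef_trace_ge0 n S (E : 'M[R]_(p, n)) :
  sym_posdef S -> 0 <= \tr (E^T *m S *m E).
Proof.
move=> [_ Spos]; apply: sumr_ge0 => i _.
(* The diagonal entries are values of the quadratic form at the columns of [E]. *)
have -> : (E^T *m S *m E) i i = ((col i E)^T *m S *m col i E) 0 0.
  rewrite tr_col -row_mul [LHS]mxE [RHS]mxE; apply: eq_bigr => j _.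
  by congr (_ * _); rewrite [RHS]mxE.
by have [->|/Spos/ltW //] := eqVneq (col i E) 0; rewrite mulmx0 mxE.
Qed.

Lemma posdef_unit S : sym_posdef S -> S \in unitmx.
Proof.
move=> [_ Spos]; rewrite -row_full_unit -cokermx_eq0; apply/eqP/matrixP => i j.
rewrite mxE; have [/colP/(_ i)|/Spos] := eqVneq (col j (cokermx S)) 0.
  by rewrite !mxE.
by rewrite -mulmxA colE (mulmxA S) mulmx_coker !(mul0mx, mulmx0) mxE ltxx.
Qed.

End PosDef.

(** * Existence of the positive definite square root, and the Sylvester inequality *)

Section SquareRoot.
Variable R : realType.

Lemma interpolation (F : fieldType) (s : seq F) (f : F -> F) :
  exists q : {poly F}, {in s, forall x, q.[x] = f x}.
Proof.
elim: s => [|a s [q qP]]; first by exists 0.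
have [as_|as_] := boolP (a \in s).
  by exists q => x; rewrite inE => /predU1P[->|]; exact: qP.
pose w : {poly F} := \prod_(b <- s) ('X - b%:P).
have w0 x : (w.[x] == 0) = (x \in s) by rewrite -root_prod_XsubC.
(* Newton step: [w] vanishes exactly on [s], so the correction changes the value at [a] only. *)
exists (q + ((f a - q.[a]) / w.[a]) *: w) => x; rewrite !hornerE.
rewrite inE => /predU1P[->|xs]; first by rewrite divfK ?w0 // addrC subrK.
by move: (w0 x); rewrite xs => /eqP->; rewrite mulr0 addr0 qP.
Qed.

Lemma posdef_eigenvalue_gt0 n (M : 'M[R]_n) a :
  sym_posdef M -> eigenvalue M a -> 0 < a.
Proof.
move=> [_ Mpos] /eigenvalueP[v vM v0].
have /Mpos : v^T != 0 by rewrite trmx_eq0.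
have := mxtrace_trmul_ge0 v^T; rewrite trmxK vM -scalemxAl mxE /mxtrace big_ord1.
rewrite le_eqVlt => /predU1P[<-|vv]; first by rewrite mulr0 ltxx.
by rewrite pmulr_lgt0.
Qed.

Local Notation cplx := (real_complex R).

(* Interpolating the fourth root on the spectrum makes the root a real
   polynomial in [M], although [M] is diagonalized over the complex numbers.
   A fourth root is needed because its square is a positive definite square
   root. *)
Lemma posdef_fourth_root_succ n (M : 'M[R]_n.+1) : sym_posdef M ->
  exists Y : 'M[R]_n.+1, Y^T = Y /\ Y *m Y *m (Y *m Y) = M.
Proof.
move=> Mpos; pose MC := map_mx cplx M.
have MCreal : MC \is a realmx.
  by apply/mxOverP => i j; rewrite mxE; by apply/complex_realP; exists (M i j).
have MCherm : MC \is hermsymmx.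
  apply: realsym_hermsym => //.
  apply/is_hermitianmxP; rewrite expr0 scale1r map_mx_id //.
  by rewrite /MC map_trmx Mpos.1.
have /orthomx_spectralP MCE := hermitian_normalmx MCherm.
have Dreal := hermitian_spectral_diag_real MCherm.
have Punit := spectral_unit MC.
set P := spectralmx MC in MCE Punit; set D := spectral_diag MC in MCE Dreal.
pose d i := complex.Re (D 0 i).
have dE i : D 0 i = cplx (d i).
  by rewrite /d RRe_real //; exact: (mxOverP Dreal).
have dpos i : 0 < d i.
  apply: (posdef_eigenvalue_gt0 Mpos).
  (* [M] and [MC] share their characteristic polynomial up to the embedding, so real eigenvalues of
     [MC] descend to [M]; row [i] of [P] is a left eigenvector. *)
  suff: eigenvalue MC (D 0 i).
    by rewrite !eigenvalue_root_char dE -map_char_poly fmorph_root.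
  apply/eigenvalueP; exists (row i P).
    by rewrite -row_mul -/MC MCE !mulmxA mulmxV // mul1mx row_mul row_diag_mx
      -scalemxAl -rowE.
  apply: contra_neq (oner_neq0 R[i]) => Pi0.
  have /matrixP/(_ 0 i) : row i (P *m invmx P) = 0 by rewrite row_mul Pi0 mul0mx.
  by rewrite mulmxV // !mxE eqxx.
have [q qP] := interpolation [seq d i | i : 'I_n.+1]
  (fun x => Num.sqrt (Num.sqrt x)).
exists (horner_mx M q); split.
  (* A polynomial in a symmetric matrix is symmetric, since its powers commute. *)
  elim/poly_ind: (q) => [|r c IH]; first by rewrite !rmorph0 trmx0.
  rewrite rmorphD rmorphM /= horner_mx_X horner_mx_C linearD /= tr_scalar_mx.
  congr (_ + _); rewrite [LHS]trmx_mul IH Mpos.1.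
  exact: comm_mx_horner.
have -> : horner_mx M q *m horner_mx M q *m (horner_mx M q *m horner_mx M q) =
  horner_mx M (q ^+ 4).
  by rewrite rmorphXn /= (exprM _ 2 2) !expr2.
(* Over the complex numbers [q ^+ 4] acts on the diagonal, where it fixes each eigenvalue by the
   choice of [q]. *)
apply: (map_mx_inj (f := cplx)).
rewrite map_horner_mx -/MC {1}MCE horner_mx_uconjC // [in RHS]MCE.
rewrite horner_mx_diag; congr (_ *m diag_mx _ *m _).
apply/rowP => i; rewrite mxE dE horner_map horner_exp.
rewrite qP ?map_f ?mem_enum // (exprM _ 2 2) !sqr_sqrtr ?sqrtr_ge0 //.
exact: ltW.
Qed.

Lemma posdef_fourth_root n (M : 'M[R]_n) : sym_posdef M ->
  exists Y : 'M[R]_n, Y^T = Y /\ Y *m Y *m (Y *m Y) = M.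
Proof.
case: n M => [|n] M Mpos; last exact: posdef_fourth_root_succ.
by exists 0; split; apply/matrixP => -[].
Qed.

Lemma posdef_sqr n (Y : 'M[R]_n) : Y^T = Y -> Y \in unitmx -> sym_posdef (Y *m Y).
Proof.
move=> YT Yu; split=> [|x x0]; first by rewrite trmx_mul YT.
have Yx0 : Y *m x != 0.
  by apply: contra_neq x0 => Yx0; rewrite -(mulKmx Yu x) Yx0 mulmx0.
have -> : (x^T *m (Y *m Y) *m x) 0 0 = frobenius (Y *m x) ^+ 2.
  by rewrite frobenius_sqr trmx_mul YT /mxtrace big_ord1 !mulmxA.
rewrite exprn_gt0 // lt0r frobenius_ge0 andbT.
by apply: contra_neq Yx0 => Yx0; apply: frobenius0_eq0; rewrite Yx0.
Qed.

Lemma sqrtmxP n (M : 'M[R]_n) : sym_posdef M ->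
  sym_posdef (sqrtmx M) /\ sqrtmx M *m sqrtmx M = M.
Proof.
move=> Mpos; have [Y [YT Y4]] := posdef_fourth_root Mpos.
apply: (@xgetPex _ 0 [set S : 'M[R]_n | sym_posdef S /\ S *m S = M]%classic).
(* The fourth root [Y] is invertible because its fourth power [M] is, which makes [Y *m Y] positive
   definite. *)
exists (Y *m Y); split=> //; apply: posdef_sqr => //; have := posdef_unit Mpos.
by rewrite -Y4 !unitmx_mul => /andP[/andP[]].
Qed.

Lemma posdef_factor n (S : 'M[R]_n) : sym_posdef S ->
  exists Y : 'M[R]_n, S = Y *m Y^T.
Proof.
move=> /posdef_fourth_root[Y [YT <-]]; exists (Y *m Y).
by rewrite trmx_mul YT.
Qed.

(** The cross term is nonnegative: with [S2 = Y Y^T], cyclicity turns it into the trace of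
    [(E Y)^T S1 (E Y)]. *)
Lemma frobenius_sylvester_ge n (S1 S2 E : 'M[R]_n) :
  sym_posdef S1 -> sym_posdef S2 ->
  frobenius (S1 *m E) ^+ 2 + frobenius (E *m S2) ^+ 2 <=
  frobenius (S1 *m E + E *m S2) ^+ 2.
Proof.
move=> S1pos S2pos; rewrite frobenius_sqrD -addrA lerD2l lerDr mulrn_wge0 //.
have [Y ->] := posdef_factor S2pos.
rewrite trmx_mul S1pos.1 !mulmxA mxtrace_mulC !mulmxA -trmx_mul -mulmxA.
exact: posdef_trace_ge0.
Qed.

End SquareRoot.

Ltac mxring := apply/matrixP => ? ?; rewrite !mxE; ring.

(** * Differential calculus with quadratic remainders *)

Section QuadraticApproximation.
Variables (R : realType) (V : normedModType R).

(* A remainder bound of order [`|h| ^+ 2], rather than [o(h)], lets the calculus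
   rules be proved with explicit constants; the cut-off [`|h| <= 1] absorbs the
   terms of higher order. *)
Record quad_diff m n (f : V -> 'M[R]_(m, n)) (x : V) (L : V -> 'M[R]_(m, n))
    : Prop :=
  QuadDiff {
    quad_diff_linear : linear L;
    quad_diff_bounded : exists2 c, 0 <= c & forall h, frobenius (L h) <= c * `|h|;
    quad_diff_rem : exists2 c, 0 <= c & forall h, `|h| <= 1 ->
      frobenius (f (x + h) - f x - L h) <= c * `|h| ^+ 2 }.

Lemma quad_diff_differentiable m n (f : V -> 'M[R]_(m, n)) x L :
  quad_diff f x L -> differentiable f x /\ 'd f x = L :> (V -> 'M[R]_(m, n)).
Proof.
move=> [Llin [c c0 Lc] [K K0 fK]].
pose L' : {linear V -> 'M[R]_(m, n)} :=
  HB.pack L (GRing.isLinear.Build R V 'M[R]_(m, n) *:%R L Llin).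
have Lcont : continuous L'.
  apply/linear_bounded_continuous/linear_boundedP.
  exists c; split; first exact: ger0_real.
  move=> r cr h; rewrite (le_trans (mx_norm_le_frobenius _)) //.
  by rewrite (le_trans (Lc h)) // ler_wpM2r // ltW.
have fE : f \o shift x = cst (f x) + L' +o_ 0 id.
  apply/eqaddoP => e e0; near=> h.
  have h1 : `|h| <= 1 by near: h; exact: nbhs0_le.
  (* [K + 1] instead of [K] keeps the divisor positive when [K = 0]. *)
  have hK : (K + 1) * `|h| <= e.
    rewrite -ler_pdivlMl ?ltr_wpDl //.
    by near: h; apply: nbhs0_le; rewrite mulr_gt0 ?invr_gt0 ?ltr_wpDl.
  rewrite (le_trans (mx_norm_le_frobenius _)) //.
  have -> : (f \o shift x - (cst (f x) + L')) h = f (x + h) - f x - L h.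
    by rewrite !fctE /= opprD addrA [h + x]addrC.
  rewrite (le_trans (fK h h1)) // expr2 mulrA ler_wpM2r //.
  by rewrite (le_trans _ hK) // ler_wpM2r // lerDl.
have dL : 'd f x = L' :> (V -> 'M[R]_(m, n)) by apply: diff_unique.
split=> //; apply/diff_locallyP; rewrite dL.
by split.
Unshelve. all: by end_near. Qed.

Lemma quad_diff_lip m n (f : V -> 'M[R]_(m, n)) x L :
  quad_diff f x L -> exists2 c, 0 <= c &
    forall h, `|h| <= 1 -> frobenius (f (x + h) - f x) <= c * `|h|.
Proof.
move=> [_ [c c0 Lc] [K K0 fK]]; exists (K + c); first exact: addr_ge0.
move=> h h1; rewrite -[f (x + h) - f x](subrK (L h)).
rewrite (le_trans (ler_frobeniusD _ _)) // mulrDl lerD //.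
rewrite (le_trans (fK _ h1)) // ler_wpM2l // expr2 -[leRHS]mulr1.
by rewrite ler_wpM2l.
Qed.

Lemma quad_diff_lin m n (L : V -> 'M[R]_(m, n)) x :
  linear L -> (exists2 c, 0 <= c & forall h, frobenius (L h) <= c * `|h|) ->
  quad_diff L x L.
Proof.
move=> Llin Lb; split=> //; exists 0 => // h _.
have -> : L (x + h) = L x + L h by have := Llin 1 x h; rewrite !scale1r.
rewrite mul0r (_ : _ - _ - _ = 0) ?frobenius0 //; mxring.
Qed.

Lemma quad_diff_cstD m n (C : 'M[R]_(m, n)) f x (L : V -> 'M[R]_(m, n)) :
  quad_diff f x L -> quad_diff (fun y => C + f y) x L.
Proof.
move=> [Llin Lb [K K0 fK]]; split=> //; exists K => // h /fK.
by congr (frobenius _ <= _); mxring.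
Qed.

Lemma quad_diff_opp m n (f L : V -> 'M[R]_(m, n)) x :
  quad_diff f x L -> quad_diff (fun y => - f y) x (fun h => - L h).
Proof.
move=> [Llin [c c0 Lc] [K K0 fK]]; split.
- by move=> a u v; rewrite Llin opprD scalerN.
- by exists c => // h; rewrite frobeniusN.
exists K => // h /fK; rewrite -frobeniusN.
by congr (frobenius _ <= _); mxring.
Qed.

Lemma quad_diff_mul m n k (f : V -> 'M[R]_(m, n)) (g : V -> 'M[R]_(n, k)) x Lf Lg :
  quad_diff f x Lf -> quad_diff g x Lg ->
  quad_diff (fun y => f y *m g y) x (fun h => Lf h *m g x + f x *m Lg h).
Proof.
move=> qf qg; have [cf cf0 fl] := quad_diff_lip qf.
have [cg cg0 gl] := quad_diff_lip qg.
case: qf => Lflin [bf bf0 Lfb] [Kf Kf0 fK].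
case: qg => Lglin [bg bg0 Lgb] [Kg Kg0 gK].
have F0 := frobenius_ge0 (f x); have G0 := frobenius_ge0 (g x).
split.
- move=> a u v; rewrite Lflin Lglin mulmxDl mulmxDr -scalemxAl -scalemxAr.
  by rewrite scalerDr addrACA.
- exists (bf * frobenius (g x) + frobenius (f x) * bg).
    by rewrite addr_ge0 ?mulr_ge0.
  move=> h; rewrite (le_trans (ler_frobeniusD _ _)) // mulrDl lerD //.
    by rewrite (le_trans (ler_frobeniusM _ _)) // mulrAC ler_wpM2r.
  by rewrite (le_trans (ler_frobeniusM _ _)) // -mulrA ler_wpM2l.
exists (Kf * frobenius (g x) + frobenius (f x) * Kg + cf * cg).
  by rewrite !addr_ge0 ?mulr_ge0.
move=> h h1.
(* Two first-order remainders plus a product of increments; the latter is quadratic by the Lipschitz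
   bounds. *)
have -> : f (x + h) *m g (x + h) - f x *m g x - (Lf h *m g x + f x *m Lg h) =
    (f (x + h) - f x - Lf h) *m g x + f x *m (g (x + h) - g x - Lg h)
    + (f (x + h) - f x) *m (g (x + h) - g x).
  by rewrite !(mulmxBl, mulmxBr); mxring.
rewrite (le_trans (ler_frobeniusD _ _)) // mulrDl lerD //; last first.
  rewrite (le_trans (ler_frobeniusM _ _)) // expr2 mulrACA.
  by rewrite ler_pM ?frobenius_ge0 ?fl ?gl.
rewrite (le_trans (ler_frobeniusD _ _)) // mulrDl lerD //.
  by rewrite (le_trans (ler_frobeniusM _ _)) // mulrAC ler_wpM2r // fK.
by rewrite (le_trans (ler_frobeniusM _ _)) // -mulrA ler_wpM2l // gK.
Qed.

Lemma quad_diff_col_mx m1 m2 n (f : V -> 'M[R]_(m1, n)) (g : V -> 'M[R]_(m2, n))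
    x Lf Lg :
  quad_diff f x Lf -> quad_diff g x Lg ->
  quad_diff (fun y => col_mx (f y) (g y)) x (fun h => col_mx (Lf h) (Lg h)).
Proof.
have le_col (A : 'M[R]_(m1, n)) (B : 'M[R]_(m2, n)) :
    frobenius (col_mx A B) <= frobenius A + frobenius B.
  rewrite -ler_sqr ?nnegrE ?addr_ge0 ?frobenius_ge0 // frobenius_col_mx sqrrD.
  by rewrite addrAC lerDl mulrn_wge0 // mulr_ge0 ?frobenius_ge0.
move=> [Lflin [bf bf0 Lfb] [Kf Kf0 fK]] [Lglin [bg bg0 Lgb] [Kg Kg0 gK]]; split.
- by move=> a u v; rewrite Lflin Lglin scale_col_mx add_col_mx.
- exists (bf + bg); first exact: addr_ge0.
  by move=> h; rewrite (le_trans (le_col _ _)) // mulrDl lerD.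
exists (Kf + Kg); first exact: addr_ge0.
move=> h h1; rewrite !opp_col_mx !add_col_mx (le_trans (le_col _ _)) //.
by rewrite mulrDl lerD ?fK ?gK.
Qed.

(** The contraction hypothesis bounds the inverse at [x + h] uniformly in [h], so the remainder
    constant is explicit. *)
Lemma quad_diff_invmx p (f : V -> 'M[R]_p) x L :
  (forall y, f y \in unitmx) ->
  (forall y n (Z : 'M[R]_(p, n)), frobenius (invmx (f y) *m Z) <= frobenius Z) ->
  quad_diff f x L ->
  quad_diff (fun y => invmx (f y)) x
    (fun h => - (invmx (f x) *m L h *m invmx (f x))).
Proof.
move=> fu fi qf; have [c c0 fl] := quad_diff_lip qf.
case: qf => Llin [b b0 Lb] [K K0 fK].
set T := invmx (f x); have T0 : 0 <= frobenius T := frobenius_ge0 T.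
split.
- move=> a u v; rewrite Llin mulmxDr mulmxDl -scalemxAr -scalemxAl opprD.
  by rewrite scalerN.
- exists (b * frobenius T); first exact: mulr_ge0.
  move=> h; rewrite frobeniusN -mulmxA (le_trans (fi _ _ _)) //.
  by rewrite (le_trans (ler_frobeniusM _ _)) // mulrAC ler_wpM2r.
exists (c * frobenius T * c * frobenius T + K * frobenius T).
  by rewrite addr_ge0 ?mulr_ge0.
move=> h h1; set T' := invmx (f (x + h)); set D := f (x + h) - f x.
have T'E : T' - T = - (T' *m D *m T).
  by rewrite mulmxBr mulmxBl mulVmx // mul1mx mulmxK // opprB.
have Dc : frobenius D <= c * `|h| by exact: fl.
have DK : frobenius (D - L h) <= K * `|h| ^+ 2 by exact: fK.
have T'fi n (Z : 'M[R]_(p, n)) : frobenius (T' *m Z) <= frobenius Z by exact: fi.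
clearbody T' D.
(* The identity [T' - T = - T' D T], substituted into itself once, leaves a term quadratic in [D]
   and the remainder of [f]. *)
have -> : T' - T - - (T *m L h *m T) =
    T' *m (D *m T *m (D *m T)) - T *m ((D - L h) *m T).
  have e : T' *m D *m T = T *m D *m T - T' *m D *m T *m D *m T.
    rewrite -(mulmxBl _ _ T) -(mulmxBl _ _ D); congr (_ *m _ *m _).
    by rewrite -[LHS](subrK T) T'E addrC.
  by rewrite T'E e mulmxBl mulmxBr !mulmxA; mxring.
rewrite (le_trans (ler_frobeniusB _ _)) // mulrDl lerD //.
  rewrite (le_trans (T'fi _ _)) // (le_trans (ler_frobeniusM _ _)) //.
  have DT : frobenius (D *m T) <= c * frobenius T * `|h|.
    by rewrite (le_trans (ler_frobeniusM _ _)) // mulrAC ler_wpM2r.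
  rewrite -[c * _ * c * _]mulrA expr2 mulrACA ler_pM ?frobenius_ge0 //.
rewrite (le_trans (fi _ _ _)) // (le_trans (ler_frobeniusM _ _)) //.
by rewrite mulrAC ler_wpM2r.
Qed.

(** The candidate differential is the inverse of the Sylvester operator at [S x], applied to
    [L h]. *)
Lemma quad_diff_sqrt p (S M : V -> 'M[R]_p) x L :
  (forall y, sym_posdef (S y)) -> (forall y, S y *m S y = M y) ->
  (forall y n (Z : 'M[R]_(p, n)), frobenius Z <= frobenius (S y *m Z)) ->
  quad_diff M x L ->
  exists2 W, quad_diff S x W & forall h, S x *m W h + W h *m S x = L h.
Proof.
move=> Spos SS Sge qM; have [c c0 Mc] := quad_diff_lip qM.
case: qM => Llin [b b0 Lb] [K K0 MK].
(* Two base points are allowed: [y = x] makes the Sylvester operator injective with a contractive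
   inverse, and [y = x + h] bounds the increment of [S]. *)
have sylv_ge y (E : 'M[R]_p) : frobenius E <= frobenius (S y *m E + E *m S x).
  rewrite (le_trans (Sge y _ E)) // frobenius_le //.
  apply: le_trans (frobenius_sylvester_ge _ (Spos y) (Spos x)).
  by rewrite lerDl sqr_ge0.
pose sylv (E : 'M[R]_p) := S x *m E + E *m S x.
have sylv_lin : linear sylv.
  move=> a E F; rewrite /sylv mulmxDr mulmxDl -scalemxAr -scalemxAl scalerDr.
  by rewrite addrACA.
pose F : 'End('M[R]_p) := linfun
  (HB.pack sylv (GRing.isLinear.Build R 'M[R]_p 'M[R]_p *:%R sylv sylv_lin)
    : {linear 'M[R]_p -> 'M[R]_p}).
have FE E : F E = sylv E by rewrite lfunE.
have kerF : lker F == 0%VS.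
  apply/lker0P => E1 E2 /eqP; rewrite -subr_eq0 -linearB /= FE => /eqP FE0.
  apply/eqP; rewrite -subr_eq0; apply/eqP/frobenius0_eq0.
  by rewrite (le_trans (sylv_ge x _)) // -/(sylv _) FE0 frobenius0.
have FK : cancel (F^-1)%VF F := lker0_lfunVK kerF.
exists (fun h => (F^-1)%VF (L h)); last by move=> h; rewrite -[RHS]FK FE.
split.
- by move=> a u v; rewrite Llin linearP.
- exists b => // h; apply: le_trans (Lb h).
  by rewrite (le_trans (sylv_ge x _)) // -/(sylv _) -FE FK.
exists (K + c ^+ 2); first by rewrite addr_ge0 ?sqr_ge0.
move=> h h1; set E := S (x + h) - S x; set W := (F^-1)%VF (L h).
have ShE : S (x + h) = S x + E by rewrite /E [RHS]addrC subrK.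
have ME : M (x + h) - M x = S (x + h) *m E + E *m S x.
  by rewrite -!SS /E mulmxBr mulmxBl addrA subrK.
have Ec : frobenius E <= c * `|h|.
  by rewrite (le_trans (sylv_ge (x + h) E)) // -ME Mc.
rewrite (le_trans (sylv_ge x _)) // -/(sylv _).
(* Expanding [(S x + E)^2] gives [sylv E + E^2] as the increment of [M]; the remainder of [M] and
   [E^2] account for [K] and [c ^+ 2]. *)
have -> : sylv (E - W) = M (x + h) - M x - L h - E *m E.
  rewrite -FE linearB /= FK FE ME ShE /sylv.
  by clearbody E; rewrite mulmxDl; mxring.
rewrite (le_trans (ler_frobeniusB _ _)) // mulrDl lerD ?MK //.
rewrite (le_trans (ler_frobeniusM _ _)) // -exprMn expr2.
by rewrite ler_pM ?frobenius_ge0.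
Qed.

End QuadraticApproximation.

(** * Contractions under transposition and right multiplication *)

Section Contraction.
Variable R : realType.

(** The squared norm of [Q^T Z] is the pairing of [Z] with [Q Q^T Z], so Cauchy-Schwarz bounds it by
    the norm of [Z] times that of [Q^T Z]. *)
Lemma frobenius_contraction_tr m n (Q : 'M[R]_(m, n)) :
  (forall k (Z : 'M[R]_(n, k)), frobenius (Q *m Z) <= frobenius Z) ->
  forall k (Z : 'M[R]_(m, k)), frobenius (Q^T *m Z) <= frobenius Z.
Proof.
move=> Qle k Z; set q := frobenius _.
have : q ^+ 2 <= frobenius Z * q.
  rewrite /q frobenius_sqr trmx_mul trmxK -mulmxA.
  rewrite (le_trans (cauchy_schwarz_mx _ _)) // ler_wpM2l ?frobenius_ge0 //.
have := frobenius_ge0 (Q^T *m Z); rewrite -/q le_eqVlt => /predU1P[<- _|q0].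
  exact: frobenius_ge0.
by rewrite expr2 ler_pM2r.
Qed.

Lemma frobenius_contraction_mulr m n (Q : 'M[R]_(m, n)) :
  (forall k (Z : 'M[R]_(n, k)), frobenius (Q *m Z) <= frobenius Z) ->
  forall k (Z : 'M[R]_(k, m)), frobenius (Z *m Q) <= frobenius Z.
Proof.
move=> Qle k Z; rewrite -frobenius_tr trmx_mul -(frobenius_tr Z).
exact: frobenius_contraction_tr.
Qed.

End Contraction.

(** * The Cayley transform of a skew-symmetric matrix *)

Section SkewCayley.
Variables (R : realType) (p : nat) (A : 'M[R]_p).
Hypothesis skewA : A^T = - A.

Lemma skew_gramB : (1%:M - A)^T *m (1%:M - A) = 1%:M + A^T *m A.
Proof.
rewrite [(1%:M - A)^T]linearB /= trmx1 skewA opprK.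
by rewrite mulmxBr mulmx1 mulmxDl mul1mx mulNmx opprD addrA addrK.
Qed.

Lemma skew_gramD : (1%:M + A)^T *m (1%:M + A) = 1%:M + A^T *m A.
Proof.
rewrite [(1%:M + A)^T]linearD /= trmx1 skewA.
by rewrite mulmxDr mulmx1 mulmxBl mul1mx mulNmx addrA subrK.
Qed.

Lemma skew_unit : 1%:M - A \in unitmx.
Proof. exact: gram_unit skew_gramB. Qed.

Lemma CayE : Cay A = (1%:M + A) *m invmx (1%:M - A).
Proof.
rewrite /Cay -[LHS](mulmxK skew_unit) -(mulmxA _ _ (1%:M - A)).
have -> : (1%:M + A) *m (1%:M - A) = (1%:M - A) *m (1%:M + A).
  rewrite !(mulmxBl, mulmxDl, mulmxBr, mulmxDr) !mul1mx !mulmx1 mulNmx mulmxN.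
  by mxring.
by rewrite mulKmx ?skew_unit.
Qed.

Lemma Cay_add1 : Cay A + 1%:M = invmx (1%:M - A) *+ 2.
Proof.
rewrite /Cay -[X in _ + X](mulVmx skew_unit) -mulmxDr addrACA subrr addr0.
by rewrite -mulr2n raddfMn /= mulmx1.
Qed.

(** [1 + A] and [1 - A] have the same Gram matrix, so the quotient is an isometry. *)
Lemma frobenius_Cay n (Z : 'M[R]_(p, n)) : frobenius (Cay A *m Z) = frobenius Z.
Proof.
rewrite CayE -mulmxA -[in RHS](mulKVmx skew_unit Z); apply: frobenius_eq.
by rewrite (frobenius_sqr_gram skew_gramB) (frobenius_sqr_gram skew_gramD).
Qed.

Lemma frobenius_skew_resolvent n (Z : 'M[R]_(p, n)) :
  frobenius (invmx (1%:M - A) *m Z) <= frobenius Z.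
Proof. exact: frobenius_invmx_gram skew_gramB _ _. Qed.

Lemma frobenius_skew_sandwich (M : 'M[R]_p) :
  frobenius (invmx (1%:M - A) *m M *m invmx (1%:M - A)) <= frobenius M.
Proof.
rewrite (le_trans (frobenius_contraction_mulr frobenius_skew_resolvent _)) //.
exact: frobenius_skew_resolvent.
Qed.

End SkewCayley.

(** * The square root of [1 + B^T B] and the bound on its differential *)

Section SquareRootGram.
Variables (R : realType) (p k : nat) (B : 'M[R]_(k, p)).

Let S := sqrtmx (1%:M + B^T *m B).

Lemma gram_posdef : sym_posdef (1%:M + B^T *m B).
Proof.
split=> [|x x0]; first by rewrite linearD /= trmx1 trmx_mul trmxK.
rewrite mulmxDr mulmx1 mulmxDl mxE.
have trE n (C : 'M[R]_(n, 1)) : (C^T *m C) 0 0 = frobenius C ^+ 2.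
  by rewrite frobenius_sqr /mxtrace big_ord1.
rewrite mulmxA -trmx_mul -mulmxA !trE ltr_pwDl ?sqr_ge0 //.
rewrite exprn_gt0 // lt0r frobenius_ge0 andbT.
by apply: contra_neq x0 => x0; apply: frobenius0_eq0; rewrite x0.
Qed.

Lemma sqrtmx_gram_posdef : sym_posdef S.
Proof. by have [] := sqrtmxP gram_posdef. Qed.

Lemma sqrtmx_gram_sqr : S *m S = 1%:M + B^T *m B.
Proof. by have [] := sqrtmxP gram_posdef. Qed.

Lemma sqrtmx_gram : S^T *m S = 1%:M + B^T *m B.
Proof. by rewrite sqrtmx_gram_posdef.1 sqrtmx_gram_sqr. Qed.

Lemma frobenius_sylvester_mul_invmx (N : 'M[R]_(k, p)) (W : 'M[R]_p) :
  S *m W + W *m S = N^T *m B + B^T *m N ->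
  frobenius (W *m invmx S) <= 2 * frobenius N.
Proof.
move=> WE; set T := invmx S.
have Su : S \in unitmx := gram_unit sqrtmx_gram.
have TT : T^T = T by rewrite trmx_inv sqrtmx_gram_posdef.1.
have Tle n (Z : 'M[R]_(p, n)) : frobenius (T *m Z) <= frobenius Z.
  exact: frobenius_invmx_gram sqrtmx_gram _ _.
have Qle n (Z : 'M[R]_(p, n)) : frobenius (B *m T *m Z) <= frobenius Z.
  exact: frobenius_mul_invmx_gram sqrtmx_gram _ _.
have TWT : W *m T + T *m W = T *m (N^T *m B + B^T *m N) *m T.
  rewrite -WE mulmxDr mulmxDl !mulmxA mulVmx // mul1mx -!mulmxA mulmxV //.
  by rewrite mulmx1.
have V : frobenius (W *m T) <= frobenius (W *m T + T *m W).
  (* With [E = T W T], the products [S E] and [E S] are [W T] and [T W]. *)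
  have := frobenius_sylvester_ge (T *m W *m T) sqrtmx_gram_posdef sqrtmx_gram_posdef.
  rewrite -/S mulmxKV // -(mulmxA T W T) mulKVmx //.
  by move=> /(le_trans _) h; rewrite frobenius_le // h // lerDl sqr_ge0.
rewrite (le_trans V) // TWT mulmxDr mulmxDl (le_trans (ler_frobeniusD _ _)) //.
rewrite mulr_natl mulr2n lerD //.
  rewrite -!mulmxA (le_trans (Tle _ _)) //.
  rewrite (le_trans (frobenius_contraction_mulr Qle _)) //.
  by rewrite frobenius_tr.
rewrite (le_trans (frobenius_contraction_mulr Tle _)) // mulmxA -TT -trmx_mul.
exact: (frobenius_contraction_tr Qle).
Qed.

End SquareRootGram.

(** * The differential of [phiCay] and its bound *)

Section PhiCay.
Variables (R : realType) (p k : nat).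
Local Notation V := (skew_space R p * 'M[R]_(k, p))%type.
Implicit Types X H : V.

Lemma skew_valE X : (2^-1 *: skew_val X.1)^T = - (2^-1 *: skew_val X.1).
Proof. by have /eqP XT := valP X.1; rewrite linearZ /= XT scalerN. Qed.

Let skewU X := invmx (1%:M - 2^-1 *: skew_val X.1).
Let gramS X := sqrtmx (1%:M + X.2^T *m X.2).

Lemma quad_diff_skew_val a (X : V) :
  quad_diff (fun Y : V => a *: skew_val Y.1) X
    (fun H => a *: skew_val H.1).
Proof.
apply: quad_diff_lin => [b u v|].
  by rewrite [skew_val _](linearP val) scalerDr !scalerA mulrC.
exists (`|a| * (p * p)%:R) => [|H]; first exact: mulr_ge0.
rewrite frobeniusZ -mulrA ler_wpM2l // (le_trans (frobenius_le_mx_norm _)) //.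
by rewrite ler_wpM2l // prod_normE le_max lexx.
Qed.

Lemma quad_diff_snd (X : V) :
  quad_diff (fun Y : V => Y.2) X (fun H => H.2).
Proof.
apply: quad_diff_lin => //; exists (k * p)%:R => // H.
rewrite (le_trans (frobenius_le_mx_norm _)) //.
by rewrite ler_wpM2l // prod_normE le_max lexx orbT.
Qed.

Lemma quad_diff_trmx_snd (X : V) :
  quad_diff (fun Y : V => Y.2^T) X (fun H => H.2^T).
Proof.
have [_ [c c0 b] _] := quad_diff_snd X.
apply: quad_diff_lin => [a u v|]; first by rewrite linearP.
by exists c => // H; rewrite frobenius_tr.
Qed.

(** The product rule gives [U (M/2) Cay(A/2) + U (M/2)] in the direction [M], and
    [Cay(A/2) + 1 = 2 U] collapses this to [U M U]. *)
Lemma quad_diff_Cay (X : V) :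
  exists2 L, quad_diff
    (fun Y : V => Cay (2^-1 *: skew_val Y.1)) X L
  & forall H, L H = skewU X *m skew_val H.1 *m skewU X.
Proof.
have qU := quad_diff_invmx (fun Y => skew_unit (skew_valE Y))
  (fun Y => frobenius_skew_resolvent (skew_valE Y))
  (quad_diff_cstD 1%:M (quad_diff_opp (quad_diff_skew_val 2^-1 X))).
eexists; first exact: quad_diff_mul qU
  (quad_diff_cstD 1%:M (quad_diff_skew_val 2^-1 X)).
move=> H /=; rewrite -/(skewU X) mulmxN !mulNmx opprK.
rewrite -(mulmxA _ (skewU X)) -/(Cay (2^-1 *: skew_val X.1)).
rewrite -[X in _ + X]mulmx1 -mulmxDr Cay_add1 ?skew_valE // -/(skewU X).
rewrite raddfMn /= -!scalemxAr -!scalemxAl -scaler_nat.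
by rewrite scalerA mulfV ?scale1r ?pnatr_eq0.
Qed.

Lemma quad_diff_sqrt_gram (X : V) :
  exists2 W, quad_diff
    (fun Y : V => gramS Y) X W
  & forall H, gramS X *m W H + W H *m gramS X = H.2^T *m X.2 + X.2^T *m H.2.
Proof.
apply: (quad_diff_sqrt (fun Y => sqrtmx_gram_posdef Y.2)
  (fun Y => sqrtmx_gram_sqr Y.2) (fun Y => frobenius_gram_ge (sqrtmx_gram Y.2))).
exact: quad_diff_cstD _ (quad_diff_mul (quad_diff_trmx_snd X) (quad_diff_snd X)).
Qed.

(** Since the Cayley block is an isometry, the stacked matrix has the same Gram matrix [1 + B^T B]
    as the square root. *)
Lemma frobenius_Cay_stack n (A : 'M[R]_p) (B : 'M[R]_(k, p)) (Z : 'M[R]_(p, n)) :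
  A^T = - A ->
  frobenius (col_mx (Cay A) B *m Z) = frobenius (sqrtmx (1%:M + B^T *m B) *m Z).
Proof.
move=> skewA; apply: frobenius_eq; rewrite mul_col_mx frobenius_col_mx.
by rewrite frobenius_Cay // (frobenius_sqr_gram (sqrtmx_gram B)).
Qed.

Lemma quad_diff_phiCay (X : V) :
  exists2 L, quad_diff (@phiCay R _ p k erefl) X L
  & forall H, frobenius (L H) <= 3 * frobenius (@stack R _ p k erefl H).
Proof.
have [LC qC LCE] := quad_diff_Cay X.
have [W qS WE] := quad_diff_sqrt_gram X.
have qT := quad_diff_invmx (fun Y => gram_unit (sqrtmx_gram Y.2))
  (fun Y => frobenius_invmx_gram (sqrtmx_gram Y.2)) qS.
have -> : @phiCay R _ p k erefl = fun Y : V =>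
    col_mx (Cay (2^-1 *: skew_val Y.1)) Y.2 *m invmx (gramS Y).
  by apply/funext => Y; rewrite /phiCay castmx_id.
eexists; first exact: quad_diff_mul (quad_diff_col_mx qC (quad_diff_snd X)) qT.
move=> H /=; rewrite /stack castmx_id -/(gramS X).
set T := invmx (gramS X); set h := frobenius (col_mx (skew_val H.1) H.2).
have Tle n (Z : 'M[R]_(p, n)) : frobenius (T *m Z) <= frobenius Z.
  exact: frobenius_invmx_gram (sqrtmx_gram _) _ _.
have H2 : frobenius H.2 <= h.
  by rewrite frobenius_le // frobenius_col_mx lerDr sqr_ge0.
have LH : frobenius (col_mx (LC H) H.2 *m T) <= h.
  rewrite (le_trans (frobenius_contraction_mulr Tle _)) // frobenius_le //.
  rewrite !frobenius_col_mx lerD2r ler_sqr ?nnegrE ?frobenius_ge0 // LCE.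
  exact: frobenius_skew_sandwich (skew_valE X) _.
have WT : frobenius (W H *m T) <= 2 * h.
  apply: le_trans (frobenius_sylvester_mul_invmx (WE H)) _.
  by rewrite ler_wpM2l.
rewrite (le_trans (ler_frobeniusD _ _)) //.
(* The stacked factor is traded for [S], which cancels the leading [T] of [T W T]; the bounds [h]
   and [2 h] add up to [3 h]. *)
rewrite mulmxN frobeniusN frobenius_Cay_stack ?skew_valE //.
rewrite -mulmxA mulKVmx ?(gram_unit (sqrtmx_gram _)) //; lra.
Qed.

End PhiCay.

Theorem lemma3p10 (R : realType) (n p : nat) (hp : (0 < p)%N) (hpn : (p <= n)%N)
    (X : (skew_space R p * 'M[R]_(n - p, p))%type) :
  differentiable (phiCay (subnKC hpn)) X /\
  (abs_cond_phiCay (subnKC hpn) X <= 3%:E)%E.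
Proof.
(* Generalizing [n - p] lets the dimension equation be eliminated, so the casts become trivial. *)
move: (n - p)%N (subnKC hpn) X => k e; case: n / e {hpn} => X.
have [L qL Lle] := quad_diff_phiCay X.
have [df dE] := quad_diff_differentiable qL; split=> //.
rewrite /abs_cond_phiCay /opnorm dE; apply: ge_ereal_sup => _ [->|[H _ <-]].
  by rewrite lee_fin.
(* A zero denominator makes the quotient zero, by the convention [0^-1 = 0]. *)
rewrite lee_fin; have [->|h0] := eqVneq (frobenius (stack (erefl (p + k)%N) H)) 0.
  by rewrite invr0 mulr0.
by rewrite ler_pdivrMr // lt0r h0 frobenius_ge0.
Qed.
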